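(* Let $u$ be a rate function. The stationary distribution corresponding to $u$ in the SLRMP is factorised if and only if for all $m,n\in\mathbb{N}$, $$\frac{u(m,n)}{u(m,0)\,u(1,n)}=\frac{u(n+1,m-1)}{u(n+1,0)\,u(1,m-1)},$$ and likewise the stationary distribution corresponding to $u$ in the homogeneous SLRMP is factorised if and only if this same condition holds for all $m,n\in\mathbb{N}$. In this case, a one-point function corresponding to $u$ for the SLRMP is $$f(x,n)=x^n\prod_{i=1}^n\frac{u(1,i-1)}{u(i,0)},$$ and a one-point function corresponding to $u$ for the homogeneous SLRMP is $$f(n)=\prod_{i=1}^n\frac{u(1,i-1)}{u(i,0)}.$$
   Context: $\mathbb{N}=\{1,2,\dots\}$, $\mathbb{N}_0=\mathbb{N}\cup\{0\}$. For $L,N\in\mathbb{N}$, $\Omega_{L,N}=\{\eta=(\eta_1,\dots,\eta_L)\in\mathbb{N}_0^L:\sum_\ell\eta_\ell=N\}$; $\eta_\ell$ is the number of particles at site $\ell$, and sites are arranged on a ring with indices modulo $L$ increasing clockwise. A rate function is $u:\mathbb{N}_0\times\mathbb{N}_0\to\mathbb{R}_{\ge0}$ with $u(m,n)>0$ if $m\ge1$ and $u(0,n)=0$. For sites $k,\ell$, $\eta^{k,\ell}$ is given by $\eta^{k,\ell}_a=\eta_a-\delta_{k,a}+\delta_{\ell,a}$. SLRMP (symmetric long range misanthrope process) with rate function $u$ and positive rate parameters $x_1,\dots,x_L$: the continuous-time Markov chain on $\Omega_{L,N}$ in which, from $\eta$, for every ordered pair of distinct sites $k\ne\ell$ with $\eta_k\ge1$: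 if all sites strictly between $k$ and $\ell$ going right (clockwise, i.e. $k+1,\dots,\ell-1$ mod $L$) are empty, a particle moves right from $k$ to $\ell$ (giving $\eta^{k,\ell}$) at rate $x_\ell u(\eta_k,\eta_\ell)$; if all sites strictly between $k$ and $\ell$ going left (i.e. $k-1,\dots,\ell+1$ mod $L$) are empty, a particle moves left from $k$ to $\ell$ (giving $\eta^{k,\ell}$) at rate $x_\ell u(\eta_k,\eta_\ell)$. If both are possible they count as two transitions and their rates add. The homogeneous SLRMP is the case where all $x_\ell=1$. These chains are irreducible, so they have a unique stationary distribution. The stationary distribution corresponding to $u$ in the SLRMP is factorised if there is $f:\mathbb{R}_{>0}\times\mathbb{N}_0\to\mathbb{R}_{>0}$ such that for all $L,N\in\mathbb{N}$ and all positive $x_1,\dots,x_L$, the stationary distribution on $\Omega_{L,N}$ is $\pi(\eta)=\frac1{Z_{L,N}}\prod_{\ell=1}^L f(x_\ell,\eta_\ell)$, with $Z_{L,N}$ the normalising constant. In the homogeneous SLRMP it is factorised if there is $f:\mathbb{N}_0\to\mathbb{R}_{>0}$ such that for all $L,N\in\mathbb{N}$ it is $\pi(\eta)=\frac1{Z_{L,N}}\prod_{\ell=1}^L f(\eta_\ell)$. Any such $f$ is called a one-point function corresponding to $u$ (it is not unique). *)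

(* Defs.v *)
From mathcomp Require Import all_boot all_order all_algebra.
From mathcomp Require Import reals.

Set Implicit Arguments.
Unset Strict Implicit.
Unset Printing Implicit Defensive.

Import Order.TTheory GRing.Theory Num.Theory.
Local Open Scope ring_scope.

Section MarkovChain.
Variables (R : realType) (T : finType).

(* [q s t] is the rate of jumping from [s] to [t]; [q s s] is irrelevant. *)
Definition is_stationary (q : T -> T -> R) (p : {ffun T -> R}) : Prop :=
  [/\ forall s, 0 <= p s,
      \sum_s p s = 1
    & forall t, \sum_(s | s != t) p s * q s t = p t * \sum_(s | s != t) q t s].

Definition is_the_stationary (q : T -> T -> R) (p : {ffun T -> R}) : Prop :=
  unique (is_stationary q) p.

End MarkovChain.

(* The occupation numbers are bounded by [N] only to make the type finite:
   this is automatic when they sum to [N]. *)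
Definition config (L N : nat) :=
  {eta : {ffun 'I_L -> 'I_N.+1} | (\sum_l (eta l : nat))%N == N}.

Definition occ (L N : nat) (eta : config L N) (l : 'I_L) : nat := val eta l.
Coercion occ : config >-> Funclass.

(* Number of clockwise steps from [k] to [l] on the ring, in [0, L - 1]. *)
Definition cw_dist (L : nat) (k l : 'I_L) : nat := ((l + (L - k)) %% L)%N.

Section SLRMP.
Variables (L N : nat).

Definition right_clear (eta : config L N) (k l : 'I_L) : bool :=
  [forall a : 'I_L, (0 < cw_dist k a < cw_dist k l)%N ==> (eta a == 0%N)].

(* [cw_dist a k] is the number of counterclockwise steps from [k] to [a]. *)
Definition left_clear (eta : config L N) (k l : 'I_L) : bool :=
  [forall a : 'I_L, (0 < cw_dist a k < cw_dist l k)%N ==> (eta a == 0%N)].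

(* [zeta] is eta^{k,l}; only used when [eta k >= 1], so that the truncated
   subtraction is exact. *)
Definition is_move (eta : config L N) (k l : 'I_L) (zeta : config L N) : bool :=
  [forall a : 'I_L, zeta a == (eta a - (k == a) + (l == a))%N].

Variable R : realType.

Definition slrmp_rate (u : nat -> nat -> R) (x : 'I_L -> R)
    (eta zeta : config L N) : R :=
  \sum_(k : 'I_L) \sum_(l : 'I_L | [&& k != l, (0 < eta k)%N & is_move eta k l zeta])
    ((if right_clear eta k l then x l * u (eta k) (eta l) else 0)
     + (if left_clear eta k l then x l * u (eta k) (eta l) else 0)).

Definition product_law (w : 'I_L -> nat -> R) : {ffun config L N -> R} :=
  [ffun eta : config L N =>
    (\prod_(l : 'I_L) w l (eta l))
    / \sum_(zeta : config L N) \prod_(l : 'I_L) w l (zeta l)].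

End SLRMP.

Section Factorisation.
Variable R : realType.
Implicit Type u : nat -> nat -> R.

Definition rate_function u : Prop :=
  [/\ forall m n, 0 <= u m n,
      forall m n, (0 < m)%N -> 0 < u m n
    & forall n, u 0%N n = 0].

(* Only the values of [f] at positive first arguments matter. *)
Definition one_point u (f : R -> nat -> R) : Prop :=
  (forall x n, 0 < x -> 0 < f x n) /\
  forall (L N : nat) (x : 'I_L -> R), (0 < L)%N -> (0 < N)%N ->
    (forall l, 0 < x l) ->
    is_the_stationary (@slrmp_rate L N R u x) (product_law N (fun l => f (x l))).

Definition factorised u : Prop := exists f, one_point u f.

Definition one_point_hom u (f : nat -> R) : Prop :=
  (forall n, 0 < f n) /\
  forall L N : nat, (0 < L)%N -> (0 < N)%N ->
    is_the_stationary (@slrmp_rate L N R u (fun=> 1)) (product_law N (fun=> f)).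

Definition factorised_hom u : Prop := exists f, one_point_hom u f.

Definition rate_symmetry u : Prop :=
  forall m n : nat, (0 < m)%N -> (0 < n)%N ->
    u m n / (u m 0%N * u 1%N n)
    = u n.+1 (m - 1)%N / (u n.+1 0%N * u 1%N (m - 1)%N).

End Factorisation.

(* Main.v *)
Require Import Defs.
From mathcomp Require Import all_boot all_order all_algebra.
From mathcomp Require Import reals.
From mathcomp Require Import ring zify.

Set Implicit Arguments.
Unset Strict Implicit.
Unset Printing Implicit Defensive.

Import Order.TTheory GRing.Theory Num.Theory.
Local Open Scope ring_scope.

(** A particle that jumps from [k] to [l] over empty sites leaves these sites
    empty, so it can jump back from [l] to [k] over them.  Each transition thus
    has a reverse one, and for a product law with one-point function [f]
    detailed balance becomes a condition on the two sites involved: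
    [f m.+1 * f n * u m.+1 n = f m * f n.+1 * u n.+1 m]
    in the homogeneous case.  The factors [x k ^+ eta k] absorb the rate
    parameters, which multiply the rate of a jump by the [x] of its target.

    Taking [n = 0] in this condition determines [f] up to geometric factors as
    the product of the statement, and with this [f] the condition is exactly
    the symmetry of [u m n / (u m 0 * u 1 n)] ([weight_bond]).  So under the
    symmetry the product law is reversible, hence stationary.  It is the only
    stationary law because the density of another one with respect to it is
    harmonic, so it is maximal and minimal at the configuration with all
    particles at one site, which can be reached from everywhere
    ([reversible_is_the_stationary], [closed_gathered]).

    Conversely, two sites are enough to force the symmetry.  For [L = 2] the
    configurations lie on a line and each jump goes to a neighbour, so in a
    stationary law the current between any two neighbours vanishes
    ([stationary_cut]); this is the two-site condition above
    ([one_point_hom_cut]).  A factorised law of the general process specialises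
    to the homogeneous one at [x = 1], so the same argument covers both. *)

(** * Finite Markov chains *)

Section Chains.
Variables (R : realType) (T : finType) (q : T -> T -> R).

Definition detailed_balance (p : T -> R) : Prop :=
  forall s t, s != t -> p s * q s t = p t * q t s.

Definition closed_under_jumps (A : pred T) : Prop :=
  forall s t, s != t -> A s -> 0 < q s t -> A t.

(** Summing the balance equations over [A], the currents inside [A] cancel and
    only those through its boundary remain. *)
Lemma stationary_cut (p : {ffun T -> R}) (A : pred T) :
  is_stationary q p ->
  \sum_(s | A s) \sum_(t | ~~ A t) p s * q s t
  = \sum_(s | A s) \sum_(t | ~~ A t) p t * q t s.
Proof.
move=> [_ _ bal].
(* The diagonal terms are added on both sides to get unrestricted sums. *)
have full t : \sum_s p t * q t s = \sum_s p s * q s t.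
  by rewrite (bigD1 t) //= [RHS](bigD1 t) //= bal mulr_sumr.
have : \sum_(t | A t) \sum_s p t * q t s = \sum_(t | A t) \sum_s p s * q s t.
  exact: eq_bigr.
under eq_bigr => t _ do rewrite (bigID A) /=.
under [in RHS]eq_bigr => t _ do rewrite (bigID A) /=.
by rewrite !big_split /= [X in _ = X + _]exchange_big /= => /addrI.
Qed.

Hypothesis q_ge0 : forall s t, 0 <= q s t.

(** At a state where [h] is maximal, harmonicity is a vanishing sum of
    nonnegative terms, so the set of maximum points is closed under jumps. *)
Lemma harmonic_max (h : T -> R) (c : T) :
  (forall A, closed_under_jumps A -> (exists s, A s) -> A c) ->
  (forall t, \sum_(s | s != t) q t s * (h t - h s) = 0) ->
  forall s, h s <= h c.
Proof.
move=> reach harm.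
pose A := [pred t | [forall s, h s <= h t]].
suff : A c by move=> /forallP.
apply: reach.
  move=> s t st /forallP hs qst.
  have /eqP := harm s; rewrite psumr_eq0; last first.
    by move=> a _; rewrite mulr_ge0 ?subr_ge0.
  move=> /allP /(_ t (mem_index_enum t)); rewrite eq_sym st /=.
  rewrite mulf_eq0 gt_eqF //= subr_eq0 => /eqP <-.
  exact/forallP.
exists [arg max_(t > c) h t]%O.
by case: Order.TotalTheory.arg_maxP => // i _ hi; apply/forallP => s; apply: hi.
Qed.

(** Detailed balance gives stationarity term by term.  If [p'] is another
    stationary law, reversibility makes the density [p' / p] harmonic, so it
    is constant by the maximum principle applied to it and its opposite. *)
Lemma reversible_is_the_stationary (p : {ffun T -> R}) (c : T) :
  (forall s, 0 < p s) -> \sum_s p s = 1 -> detailed_balance p ->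
  (forall A, closed_under_jumps A -> (exists s, A s) -> A c) ->
  is_the_stationary q p.
Proof.
move=> p_gt0 p1 db reach; split.
  split=> [s||t] //; first exact: ltW.
  by rewrite mulr_sumr; apply: eq_bigr => s st; rewrite db.
move=> p' [_ p'1 bal'].
pose h s := p' s / p s.
have p'E s : p' s = h s * p s by rewrite /h mulfVK // gt_eqF.
have harm t : \sum_(s | s != t) q t s * (h t - h s) = 0.
  apply: (mulfI (lt0r_neq0 (p_gt0 t))); rewrite mulr0 mulr_sumr.
  have /eqP := bal' t; rewrite eq_sym -subr_eq0 mulr_sumr -sumrB => /eqP e0.
  rewrite -[RHS]e0; apply: eq_bigr => s st; rewrite !p'E.
  have e := db s t st.
  by rewrite -[h s * p s * q s t]mulrA e; ring.
have hle := @harmonic_max h c reach harm.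
have hge s : - h s <= - h c.
  apply: (@harmonic_max (fun s => - h s)) => // t.
  rewrite -[RHS]oppr0 -[in RHS](harm t) -sumrN; apply: eq_bigr => a _; ring.
have hc s : h s = h c.
  by apply/eqP; rewrite eq_le hle /= -lerN2 hge.
have hc1 : h c = 1.
  rewrite -p'1 -[LHS]mulr1 -p1 mulr_sumr.
  by apply: eq_bigr => s _; rewrite p'E hc.
by apply/ffunP => s; rewrite p'E hc hc1 mul1r.
Qed.

End Chains.

(** * Configurations and moves *)

Section Configurations.
Variables (L N : nat).
Implicit Types eta zeta : config L N.

Lemma config_eq eta zeta : (forall l, eta l = zeta l) -> eta = zeta.
Proof. by move=> e; apply/val_inj/ffunP => l; apply: val_inj; apply: e. Qed.

Lemma config_sum eta : (\sum_l eta l)%N = N.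
Proof. exact/eqP/(valP eta). Qed.

Lemma config_of (g : 'I_L -> nat) :
  (\sum_l g l)%N = N -> exists eta, forall l, eta l = g l.
Proof.
move=> sg.
have ok l : nat_of_ord (inord (g l) : 'I_N.+1) = g l.
  by rewrite inordK // ltnS -sg (bigD1 l) //= leq_addr.
have gN : (\sum_l ([ffun l => inord (g l) : 'I_N.+1] l : nat))%N == N.
  by apply/eqP; rewrite -[RHS]sg; apply: eq_bigr => l _; rewrite ffunE ok.
by exists (Sub [ffun l => inord (g l)] gN) => l; rewrite /occ /= ffunE ok.
Qed.

Lemma is_moveP eta k l zeta :
  reflect (forall a, zeta a = (eta a - (k == a) + (l == a))%N)
          (is_move eta k l zeta).
Proof. by apply: (iffP forallP) => h a; apply/eqP; apply: h. Qed.

Lemma move_exists eta k l :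
  k != l -> (0 < eta k)%N -> exists zeta, is_move eta k l zeta.
Proof.
move=> kl ek.
have [|zeta hz] := @config_of (fun a => eta a - (k == a) + (l == a))%N.
  have lk : l != k by rewrite eq_sym.
  rewrite -[RHS](config_sum eta) (bigD1 k) //= [RHS](bigD1 k) //=.
  rewrite (bigD1 l) //=
    [X in (_ + X)%N = _](_ : _ = eta l + 1 + \sum_(i | (i != k) && (i != l)) eta i)%N.
    rewrite [X in _ = (_ + X)%N](bigD1 l) //= !eqxx (negbTE lk); lia.
  rewrite (negbTE kl) eqxx subn0; congr (_ + _)%N.
  apply: eq_bigr => a /andP[ak al].
  by rewrite eq_sym (negbTE ak) eq_sym (negbTE al) subn0 addn0.
by exists zeta; apply/is_moveP.
Qed.

Lemma move_rev eta k l zeta :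
  k != l -> (0 < eta k)%N -> is_move eta k l zeta ->
  (0 < zeta l)%N /\ is_move zeta l k eta.
Proof.
move=> kl ek /is_moveP mv; split.
  by rewrite mv eqxx (negbTE kl); lia.
apply/is_moveP => a; rewrite mv.
by case: (eqVneq k a) => [ka|_]; case: (eqVneq l a) => [la|_]; subst; lia.
Qed.

(** The two configurations differ exactly at the emptied and the filled site.
    Hence the double sum in [slrmp_rate] has at most one nonzero term. *)
Lemma move_inj eta zeta k l k' l' :
  k != l -> (0 < eta k)%N -> is_move eta k l zeta ->
  k' != l' -> (0 < eta k')%N -> is_move eta k' l' zeta ->
  k' = k /\ l' = l.
Proof.
move=> kl ek /is_moveP mv kl' ek' /is_moveP mv'; split.
  have := mv' k'; rewrite mv eqxx eq_sym.
  case: eqP => // _; rewrite [l' == k']eq_sym (negbTE kl').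
  by case: (l == k'); lia.
have := mv' l'; rewrite mv eqxx (negbTE kl').
by case: (eqVneq l l') => // _; case: (k == l'); lia.
Qed.

Lemma cw_distE (k l : 'I_L) :
  cw_dist k l = if (k <= l)%N then (l - k)%N else (l + L - k)%N.
Proof.
have kL := ltn_ord k; have lL := ltn_ord l; rewrite /cw_dist.
case: leqP => kl; last by rewrite modn_small; lia.
by rewrite (_ : l + (L - k) = (l - k) + L)%N ?modnDr ?modn_small; lia.
Qed.

(** The sites strictly between [k] and [l] going clockwise from [k] are those
    met going counterclockwise from [l]. *)
Lemma between_rev (k l a : 'I_L) :
  (0 < cw_dist a l < cw_dist k l)%N = (0 < cw_dist k a < cw_dist k l)%N.
Proof.
have kL := ltn_ord k; have lL := ltn_ord l; have aL := ltn_ord a.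
rewrite !cw_distE.
case: (leqP a l); case: (leqP k l); case: (leqP k a); lia.
Qed.

Lemma between_neq (k l a : 'I_L) :
  (0 < cw_dist k a < cw_dist k l)%N -> (k != a) && (l != a).
Proof.
move=> /andP[h1 h2]; apply/andP; split; apply/eqP => e; subst.
  by rewrite cw_distE leqnn subnn in h1.
by rewrite ltnn in h2.
Qed.

Lemma clear_rev eta k l zeta :
  is_move eta k l zeta ->
  (right_clear eta k l = left_clear zeta l k)
  * (left_clear eta k l = right_clear zeta l k).
Proof.
move=> /is_moveP mv.
have same a : (k != a) && (l != a) -> zeta a = eta a.
  by move=> /andP[/negbTE ka /negbTE la]; rewrite mv ka la subn0 addn0.
split; apply: eq_forallb => a; last rewrite between_rev.
  by rewrite between_rev; case E: (_ < _ < _)%N;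
    rewrite //= (same _ (between_neq E)).
by case E: (_ < _ < _)%N => //=; rewrite same // andbC (between_neq E).
Qed.

Section Rates.
Variables (R : realType) (u : nat -> nat -> R) (x : 'I_L -> R).
Local Notation rate := (slrmp_rate u x).

Lemma rate_of_move eta k l zeta :
  k != l -> (0 < eta k)%N -> is_move eta k l zeta ->
  rate eta zeta = (right_clear eta k l + left_clear eta k l)%:R
                  * (x l * u (eta k) (eta l)).
Proof.
move=> kl ek mv; rewrite /slrmp_rate (bigD1 k) //= (bigD1 l) /=; last first.
  by rewrite kl ek mv.
rewrite big1 ?addr0.
  rewrite big1 ?addr0.
    by case: right_clear; case: left_clear;
      rewrite /= ?mul0r ?mul1r ?addr0 ?add0r //; ring.
  move=> k' k'k; apply: big1 => l' /and3P[kl' ek' mv'].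
  have [e _] := @move_inj eta zeta k l k' l' kl ek mv kl' ek' mv'.
  by rewrite e eqxx in k'k.
move=> l' /andP[/and3P[kl' ek' mv'] l'l].
have [_ e] := @move_inj eta zeta k l k l' kl ek mv kl' ek' mv'.
by rewrite e eqxx in l'l.
Qed.

Lemma rate_neq0 eta zeta :
  rate eta zeta != 0 ->
  exists k l, [/\ k != l, (0 < eta k)%N & is_move eta k l zeta].
Proof.
have [/existsP[k /existsP[l /and3P[]]]|] :=
  boolP [exists k, [exists l, [&& k != l, (0 < eta k)%N & is_move eta k l zeta]]].
  by exists k, l.
move=> /existsPn no; rewrite /slrmp_rate big1 ?eqxx // => k _.
apply: big_pred0 => l; apply: negbTE; have /existsPn := no k; exact.
Qed.

Hypotheses (hu : rate_function u) (x_gt0 : forall l, 0 < x l).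

Lemma rate_ge0 eta zeta : 0 <= rate eta zeta.
Proof.
have [u_ge0 _ _] := hu.
apply: sumr_ge0 => k _; apply: sumr_ge0 => l _.
by have := mulr_ge0 (ltW (x_gt0 l)) (u_ge0 (eta k) (eta l));
  case: ifP => _; case: ifP => _ ?; rewrite ?addr0 ?add0r // addr_ge0.
Qed.

(** A move from [k] to [l] is undone by the move from [l] to [k] the opposite
    way round, through the same empty sites, so that the balance of a product
    law reduces to a balance between the two sites involved. *)
Lemma product_detailed_balance (w : 'I_L -> nat -> R) :
  (forall k l m n,
     w k m.+1 * w l n * (x l * u m.+1 n) = w k m * w l n.+1 * (x k * u n.+1 m)) ->
  detailed_balance rate (fun eta => \prod_l w l (eta l)).
Proof.
move=> bond.
suff one eta zeta : rate eta zeta != 0 ->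
    (\prod_l w l (eta l)) * rate eta zeta = (\prod_l w l (zeta l)) * rate zeta eta.
  move=> s t _; have [e1|] := eqVneq (rate s t) 0; last exact: one.
  have [e2|ne2] := eqVneq (rate t s) 0; first by rewrite e1 e2 !mulr0.
  by rewrite (one t s ne2).
move=> /rate_neq0 [k [l [kl ek mv]]].
have [zl mv'] := move_rev kl ek mv.
have lk : l != k by rewrite eq_sym.
rewrite (rate_of_move kl ek mv) (rate_of_move lk zl mv').
have [-> ->] := clear_rev mv; rewrite addnC.
rewrite (bigD1 k) //= (bigD1 l) //= [in RHS](bigD1 k) //= [in RHS](bigD1 l) //=.
have /is_moveP mvE := mv.
have -> : \prod_(i | (i != k) && (i != l)) w i (zeta i)
          = \prod_(i | (i != k) && (i != l)) w i (eta i).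
  apply: eq_bigr => a /andP[ak al].
  by rewrite mvE eq_sym (negbTE ak) eq_sym (negbTE al) subn0 addn0.
have -> : zeta k = (eta k).-1 by rewrite mvE eqxx (negbTE lk) addn0 subn1.
have -> : zeta l = (eta l).+1 by rewrite mvE eqxx (negbTE kl) subn0 addn1.
case: (eta k : nat) ek => // m _ /=.
set P := \prod_(_ | _) _; set c := _%:R.
have := bond k l m (eta l); set A := w k m.+1; set B := w l _.
move=> e.
have -> : A * (B * P) * (c * (x l * u m.+1 (eta l)))
  = P * c * (A * B * (x l * u m.+1 (eta l))) by ring.
by rewrite e; ring.
Qed.

(** This is the irreducibility that uniqueness needs.  Moving a particle from
    the first nonempty site other than [0] counterclockwise to site [0] is
    always allowed, and it increases the number of particles at site [0]. *)
Lemma closed_gathered (A : pred (config L N)) (o : 'I_L)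
    (gathered : config L N) :
  o = 0%N :> nat -> gathered o = N ->
  closed_under_jumps rate A -> (exists eta, A eta) -> A gathered.
Proof.
move=> o0 gN clA [eta Aeta].
have [_ u_gt0 _] := hu.
have [n] := ubnP (N - eta o)%N; elim: n => // n IH in eta Aeta *.
rewrite ltnS => le_n.
have [/existsP[l0 hl0]|/existsPn none] :=
  boolP [exists l, (l != o) && (0 < eta l)%N]; last first.
  have eN : eta o = N.
    rewrite -[RHS](config_sum eta) (bigD1 o) //=.
    rewrite big1 ?addn0 // => l lo.
    by have := none l; rewrite lo /= -eqn0Ngt => /eqP.
  suff -> : gathered = eta by [].
  apply: config_eq => l; have [->|lo] := eqVneq l o; first by rewrite gN eN.
  have := none l; rewrite lo /= -eqn0Ngt => /eqP ->.
  by have := config_sum gathered; rewrite (bigD1 o) //= gN (bigD1 l) //=; lia.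
case: (@arg_minnP _ l0 (fun l => (l != o) && (0 < eta l)%N)
                  (fun l => l : nat) hl0) => l /andP[lo el] lmin.
have [zeta mv] := move_exists lo el.
have cl : left_clear eta l o.
  apply/forallP => a; apply/implyP; rewrite between_rev.
  move=> h; have /andP[ao al] := between_neq h.
  move: h; rewrite !cw_distE o0 /= !subn0 => /andP[_ al'].
  rewrite eqn0Ngt; apply/negP => ea.
  by have := lmin a; rewrite ea eq_sym ao leqNgt al' => /(_ isT).
have /is_moveP mvE := mv.
have zo : zeta o = (eta o).+1 by rewrite mvE eqxx (negbTE lo) subn0 addn1.
apply: (IH zeta).
  apply: (clA eta) => //.
    by apply/eqP => e; have := zo; rewrite -e; lia.
  rewrite (rate_of_move lo el mv) cl mulr_gt0 ?mulr_gt0 ?u_gt0 //.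
  by rewrite ltr0n addn1.
by have := config_sum zeta; rewrite (bigD1 o) //= zo; lia.
Qed.

Lemma product_is_the_stationary (w : 'I_L -> nat -> R) :
  (0 < L)%N -> (forall l n, 0 < w l n) ->
  (forall k l m n,
     w k m.+1 * w l n * (x l * u m.+1 n) = w k m * w l n.+1 * (x k * u n.+1 m)) ->
  is_the_stationary rate (product_law N w).
Proof.
move=> L_gt0 w_gt0 bond.
pose o := Ordinal L_gt0.
have [gathered gE] : exists eta : config L N,
    forall l, eta l = (if l == o then N else 0%N).
  by apply: config_of; rewrite (bigD1 o) //= big1 ?addn0 // => l /negbTE ->.
have W_gt0 (eta : config L N) : 0 < \prod_l w l (eta l) by apply: prodr_gt0.
have Z_gt0 : 0 < \sum_(zeta : config L N) \prod_l w l (zeta l).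
  rewrite (bigD1 gathered) //= ltr_pwDl //.
  apply: sumr_ge0 => zeta _; exact: ltW.
apply: (@reversible_is_the_stationary _ _ _ _ _ gathered).
- exact: rate_ge0.
- by move=> eta; rewrite ffunE divr_gt0.
- under eq_bigr => eta _ do rewrite ffunE.
  by rewrite -mulr_suml divff // gt_eqF.
- move=> s t st; rewrite !ffunE mulrAC (product_detailed_balance bond) //.
  by rewrite mulrAC.
- by move=> A; apply: (@closed_gathered A o) => //; rewrite gE eqxx.
Qed.

End Rates.
End Configurations.

(** * Two sites *)

Section TwoSites.
Variables (R : realType) (u : nat -> nat -> R).

Definition o0 : 'I_2 := ord0.
Definition o1 : 'I_2 := ord_max.

Lemma ord2 (l : 'I_2) : l = o0 \/ l = o1.
Proof. by case: l => [[|[|//]] i]; [left|right]; apply: val_inj. Qed.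

Lemma clear2 N (eta : config 2 N) k l : right_clear eta k l && left_clear eta k l.
Proof.
have cw2 (i j : 'I_2) : (cw_dist i j < 2)%N by rewrite /cw_dist ltn_mod.
by apply/andP; split; apply/forallP => a; apply/implyP => /andP[h1 h2];
  [have := cw2 k l | have := cw2 l k]; lia.
Qed.

(** The set [A] of configurations with at most [m] particles at the first site
    can only be left by the jump from [lo = (m, n.+1)] to [hi = (m.+1, n)] and
    entered by the reverse jump, so cutting at [A] balances these two rates. *)
Lemma one_point_hom_cut (f : nat -> R) m n :
  one_point_hom u f ->
  f m.+1 * f n * u m.+1 n = f m * f n.+1 * u n.+1 m.
Proof.
move=> [f_gt0 /(_ 2%N (m + n).+1 isT isT) [st _]].
set N := (m + n).+1 in st.
pose A := [pred eta : config 2 N | eta o0 <= m]%N.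
have pair a b : (a + b = N)%N ->
    exists eta : config 2 N, eta o0 = a /\ eta o1 = b.
  move=> ab; have [|eta h] := @config_of 2 N (fun i => if i == o0 then a else b).
    by rewrite big_ord_recl big_ord1 /= -ab.
  by exists eta; rewrite !h.
have sum2 (eta : config 2 N) : (eta o0 + eta o1 = N)%N.
  rewrite -[RHS](config_sum eta) big_ord_recl big_ord1 /=.
  by congr (_ + eta _)%N; apply: val_inj.
have eq2 (eta zeta : config 2 N) : eta o0 = zeta o0 -> eta = zeta.
  move=> e; apply: config_eq => l.
  have := sum2 eta; have := sum2 zeta; rewrite e.
  by case: (ord2 l) => ->; lia.
have [lo [lo0 lo1]] := pair m n.+1 ltac:(rewrite /N; lia).
have [hi [hi0 hi1]] := pair m.+1 n ltac:(rewrite /N; lia).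
have up : is_move lo o1 o0 hi.
  by apply/is_moveP => a; case: (ord2 a) => ->; rewrite ?lo0 ?lo1 ?hi0 ?hi1 /=; lia.
have lo1_gt0 : (0 < lo o1)%N by rewrite lo1.
have [hi0_gt0 down] := move_rev (isT : o1 != o0) lo1_gt0 up.
have only (F : config 2 N -> config 2 N -> R) :
    (forall s t : config 2 N, (s o0 <= m < t o0)%N ->
      F s t != 0 -> (t o0 <= (s o0).+1)%N) ->
    \sum_(s | A s) \sum_(t | ~~ A t) F s t = F lo hi.
  move=> F0; rewrite (bigD1 lo) /= ?lo0 //.
  rewrite [X in _ + X]big1 ?addr0 => [|s /andP[sm slo]].
    rewrite (bigD1 hi) /= ?hi0 ?ltnn // big1 ?addr0 // => t /andP[tm thi].
    apply/eqP; case: (eqVneq (F lo t) 0) => // ne.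
    rewrite -ltnNge in tm; have := F0 lo t; rewrite lo0 leqnn tm => /(_ isT ne) h.
    by case/eqP: thi; apply: eq2; rewrite hi0; lia.
  apply: big1 => t tm; rewrite -ltnNge in tm.
  apply/eqP; case: (eqVneq (F s t) 0) => // ne.
  have := F0 s t; rewrite sm tm => /(_ isT ne) h.
  by case/eqP: slo; apply: eq2; rewrite lo0; lia.
(* One jump changes the occupation of a site by at most one. *)
have := stationary_cut A st; rewrite !only; first last.
- move=> s t _; rewrite mulf_eq0 negb_or => /andP[_].
  by move=> /rate_neq0 [k [l [_ _ /is_moveP ->]]];
    case: (_ == _); case: (_ == _); lia.
- move=> s t _; rewrite mulf_eq0 negb_or => /andP[_].
  by move=> /rate_neq0 [k [l [_ _ /is_moveP ->]]];
    case: (_ == _); case: (_ == _); lia.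
rewrite (rate_of_move _ _ (isT : o1 != o0) lo1_gt0 up).
rewrite (rate_of_move _ _ (isT : o0 != o1) hi0_gt0 down).
have /andP[-> ->] := clear2 lo o1 o0; have /andP[-> ->] := clear2 hi o0 o1.
pose Z := \sum_(zeta : config 2 N) \prod_l f (zeta l).
have lawE (eta : config 2 N) :
    product_law N (fun=> f) eta = f (eta o0) * f (eta o1) / Z.
  rewrite ffunE -/Z big_ord_recl big_ord1.
  by rewrite (_ : lift ord0 ord0 = o1) //; apply: val_inj.
rewrite !lawE lo0 lo1 hi0 hi1 !mul1r => e.
have Z_neq0 : Z != 0.
  rewrite gt_eqF // /Z (bigD1 lo) //= ltr_pwDl ?prodr_gt0 //.
  by apply: sumr_ge0 => zeta _; apply: prodr_ge0 => l _; apply: ltW.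
have e' : (f m.+1 * f n * u m.+1 n) * (2%:R / Z)
          = (f m * f n.+1 * u n.+1 m) * (2%:R / Z).
  by move: e => /=; rewrite !mulr2n => e; rewrite mulrAC; ring: e.
apply: (mulIf _ e').
by rewrite mulf_neq0 ?invr_eq0 // pnatr_eq0.
Qed.

(** The two-site balance at [(a, n)] relates [u a.+1 n] to [u n.+1 a], and at
    [(n, 0)] and [(a, 0)] it expresses the denominators.  Multiplying by the
    values of [f] that occur there makes these three equations applicable. *)
Lemma one_point_hom_symmetry (f : nat -> R) :
  rate_function u -> one_point_hom u f -> rate_symmetry u.
Proof.
move=> [_ u_gt0 _] hf [//|a] n _ _.
have [f_gt0 _] := hf.
have cut := one_point_hom_cut _ _ hf.
rewrite subn1 /=.
have u_neq0 i j : u i.+1 j != 0 by rewrite gt_eqF ?u_gt0.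
have f_neq0 i : f i != 0 by rewrite gt_eqF.
apply/eqP; rewrite eqr_div ?mulf_neq0 //; apply/eqP.
have c0 := cut a n; have c1 := cut n 0%N; have c2 := cut a 0%N.
apply: (@mulfI _ (f a.+1 * f n * (f n.+1 * f 0%N) * (f a * f 1%N))).
  by rewrite !mulf_neq0.
transitivity ((f a.+1 * f n * u a.+1 n) * (f n.+1 * f 0%N * u n.+1 0%N)
              * (f a * f 1%N * u 1%N a)); first ring.
by rewrite c0 c1 -c2; ring.
Qed.

Lemma one_point_specialise (f : R -> nat -> R) :
  one_point u f -> one_point_hom u (f 1).
Proof.
move=> [f_gt0 st]; split=> [n|L N L_gt0 N_gt0]; first exact/f_gt0/ltr01.
by apply: (st L N (fun=> 1)) => // l; apply: ltr01.
Qed.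

End TwoSites.

(** * The explicit one-point function *)

Section OnePoint.
Variables (R : realType) (u : nat -> nat -> R).
Hypotheses (hu : rate_function u) (sym : rate_symmetry u).

Let g n : R := \prod_(1 <= i < n.+1) (u 1%N (i - 1)%N / u i 0%N).

Lemma weight_gt0 n : 0 < g n.
Proof.
have [_ u_gt0 _] := hu.
rewrite /g big_nat; apply: prodr_gt0 => i /andP[i_gt0 _].
by rewrite divr_gt0 ?u_gt0.
Qed.

(** Consecutive weights have ratio [u 1 k / u k.+1 0], which turns the two-site
    balance into the symmetry condition; for [n = 0] both sides agree anyway. *)
Lemma weight_bond m n : g m.+1 * g n * u m.+1 n = g m * g n.+1 * u n.+1 m.
Proof.
have [_ u_gt0 _] := hu.
have u_neq0 i j : u i.+1 j != 0 by rewrite gt_eqF ?u_gt0.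
have gS k : g k.+1 = g k * (u 1%N k / u k.+1 0%N).
  by rewrite /g big_nat_recr //= subn1.
rewrite !gS.
case: n => [|n]; first by field; rewrite !u_neq0.
have := sym (ltn0Sn m) (ltn0Sn n); rewrite subn1 /= => e.
transitivity (g m * g n.+1 * u 1%N m * u 1%N n.+1
              * (u m.+1 n.+1 / (u m.+1 0%N * u 1%N n.+1))).
  by field; rewrite !u_neq0.
by rewrite e; field; rewrite !u_neq0.
Qed.

Lemma one_point_weight : one_point u (fun x n => x ^+ n * g n).
Proof.
split=> [x n x_gt0|L N x L_gt0 _ x_gt0].
  by rewrite mulr_gt0 ?exprn_gt0 ?weight_gt0.
apply: product_is_the_stationary => // [l n|k l m n].
  by rewrite mulr_gt0 ?exprn_gt0 ?weight_gt0.
transitivity (x k ^+ m.+1 * x l ^+ n.+1 * (g m.+1 * g n * u m.+1 n)).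
  by rewrite !exprS; ring.
by rewrite weight_bond !exprS; ring.
Qed.

Lemma one_point_hom_weight : one_point_hom u g.
Proof.
split=> [n|L N L_gt0 _]; first exact: weight_gt0.
apply: product_is_the_stationary => // [l n|k l m n]; first exact: weight_gt0.
by rewrite !mul1r weight_bond.
Qed.

End OnePoint.

Theorem theorem3p7 (R : realType) (u : nat -> nat -> R)
    (hu : rate_function u) :
  [/\ factorised u <-> rate_symmetry u,
      factorised_hom u <-> rate_symmetry u
    & rate_symmetry u ->
      one_point u
        (fun x n => x ^+ n * \prod_(1 <= i < n.+1) (u 1%N (i - 1)%N / u i 0%N))
      /\ one_point_hom u
        (fun n => \prod_(1 <= i < n.+1) (u 1%N (i - 1)%N / u i 0%N))].
Proof.
have hom_sym : factorised_hom u -> rate_symmetry u.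
  by case=> f; apply: one_point_hom_symmetry.
have sym_one : rate_symmetry u -> _ := fun sym =>
  conj (one_point_weight hu sym) (one_point_hom_weight hu sym).
split=> //; split=> //.
- by move=> [f /one_point_specialise hf]; apply: hom_sym; exists (f 1).
- by move=> /sym_one [h _]; eexists; apply: h.
- by move=> /sym_one [_ h]; eexists; apply: h.
Qed.
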